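(* Let $\langle\cdot,\cdot\rangle$ be an inner product on $\mathbb{R}^m$ with induced norm $\|\cdot\|$, and let $A:[0,\infty)\to\mathbb{R}^{m,m}$ be a continuous matrix function satisfying $$\langle A(t)x,x\rangle\le\alpha(t)\langle x,x\rangle\qquad\text{for all } t\ge0,\ x\in\mathbb{R}^m,$$ for some continuous function $\alpha:[0,\infty)\to\mathbb{R}$. Let $x_j(t)$, $t\ge0$, be the solutions of the linear system $\dot x(t)=A(t)x(t)$, $t\ge0$, with initial data $x_j(0)=x_j^0\in\mathbb{R}^m$, $j=1,2,3$. Then $$d_3(x_1(t),x_2(t),x_3(t))\le\exp\Big(3\int_0^t\alpha(s)\,ds\Big)\,d_3(x_1^0,x_2^0,x_3^0),\qquad t\ge0.$$
   Context: $d_3(x_1,x_2,x_3)=\|x_1-x_2\|\,\|x_1-x_3\|\,\|x_2-x_3\|$ for $x_1,x_2,x_3\in\mathbb{R}^m$. $\mathbb{R}^{m,m}$ is the space of real $m\times m$ matrices. *)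

(* Defs.v *)
From HB Require Import structures.
From mathcomp Require Import all_boot all_order all_algebra.
From mathcomp Require Import all_classical all_reals all_analysis.
Set Implicit Arguments.
Unset Strict Implicit.
Unset Printing Implicit Defensive.
Import Order.TTheory GRing.Theory Num.Theory.
Import numFieldNormedType.Exports.
Local Open Scope classical_set_scope.
Local Open Scope ring_scope.

(* An inner product on R^m is an element of {dot 'cV[R]_m for idfun}: a real
   bilinear form that is symmetric and positive definite. *)
Definition ip_norm (R : realType) (m : nat) (ip : {dot 'cV[R]_m for idfun})
    (x : 'cV[R]_m) : R := Num.sqrt (ip x x).

Definition d3 (R : realType) (m : nat) (ip : {dot 'cV[R]_m for idfun})
    (x1 x2 x3 : 'cV[R]_m) : R :=
  ip_norm ip (x1 - x2) * ip_norm ip (x1 - x3) * ip_norm ip (x2 - x3).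

(* Derivative at t of f regarded as a function on D only: two-sided when t is
   interior to D, one-sided at an endpoint of an interval D. *)
Definition is_derive_on (R : realType) (V : normedModType R) (D : set R)
    (t : R) (f : R -> V) (df : V) : Prop :=
  (s - t)^-1 *: (f s - f t) @[s --> within D t^'] --> df.

(* The values of A and x at negative times play no role; at t = 0 the
   derivative is the right derivative. *)
Definition is_linear_ode_solution (R : realType) (m : nat) (A : R -> 'M[R]_m)
    (x0 : 'cV[R]_m) (x : R -> 'cV[R]_m) : Prop :=
  x 0 = x0 /\
  forall t : R, 0 <= t -> is_derive_on `[0, +oo[ t x (A t *m x t).

(* Main.v *)
Require Import Defs.
From mathcomp Require Import all_boot all_order all_algebra.
From mathcomp Require Import all_classical all_reals all_analysis.
From mathcomp Require Import ring.
Import Order.TTheory GRing.Theory Num.Theory.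
Import numFieldNormedType.Exports.
Local Open Scope classical_set_scope.
Local Open Scope ring_scope.

(* For two solutions [y] and [z] of the system, the squared norm [g] of
   [y - z] satisfies [g' <= 2 * alpha * g], so Gronwall's inequality bounds
   [ip_norm ip (y t - z t)] by [expR] of the integral of [alpha] times its
   initial value; [d3] is a product of three such norms. *)

Section derive_on.
Context {R : realType} {V : normedModType R}.
Implicit Types (D : set R) (t : R) (f : R -> V).

(** For [s != t], [f s] is [s - t] times the difference quotient, plus [f t]; the first term tends
    to [0 *: df]. *)
Lemma is_derive_on_cvg {D t f df} : is_derive_on D t f df ->
  f s @[s --> within D t^'] --> f t.
Proof.
move=> fD.
have -> : f t = 0 *: df + f t by rewrite scale0r add0r.
have st : s @[s --> within D t^'] --> t.
  by do 2! apply: cvg_within_filter; exact: cvg_id.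
have st0 : s - t @[s --> within D t^'] --> (0 : R).
  by rewrite -(subrr t); apply: cvgB st (cvg_cst t).
apply: cvg_trans (cvgD (cvgZ st0 fD) (cvg_cst (f t))).
apply: near_eq_cvg; near=> s => /=.
have {}st : s != t by near: s; apply: filterS (nbhs_dnbhs_neq t).
by rewrite fctE/= scalerA divff ?subr_eq0// scale1r subrK.
Unshelve. all: by end_near. Qed.

Lemma is_derive_on_continuous D f f' :
  (forall t, D t -> is_derive_on D t f (f' t)) -> {within D, continuous f}.
Proof.
move=> fD; apply/subspace_continuousP => t Dt B fB.
have := is_derive_on_cvg (fD t Dt) _ fB.
move=> H.
have {}H : \forall s \near t, s != t -> D s -> B (f s) by [].
suff: \forall s \near t, D s -> B (f s) by [].
apply: filterS H => s /= H Ds.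
(* The punctured limit says nothing at [s = t]; there [B (f t)] holds because [B] is a neighborhood
   of [f t]. *)
have [->|st] := eqVneq s t; first exact: nbhs_singleton.
exact: H.
Qed.

(** Near an interior point the constraint [D s] holds automatically, so the restricted limit is the
    full punctured one; the substitution [s = h + t] then gives the usual quotient in direction
    1. *)
Lemma is_derive_on_interior D t f df : D° t ->
  is_derive_on D t f df -> is_derive t 1 f df.
Proof.
move=> Dt fD.
suff H : h^-1 *: ((f \o shift t) (h *: 1) - f t) @[h --> 0^'] --> df.
  split; first by apply/cvg_ex; exists df.
  exact: cvg_lim.
move=> B /fD H.
have {}H : \forall s \near t, s != t -> D s ->
  B ((s - t)^-1 *: (f s - f t)) by [].
have {}H : \forall s \near t, s != t -> B ((s - t)^-1 *: (f s - f t)).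
  by apply: filterS2 Dt H => s Ds H st; exact: H.
suff: \forall h \near (0 : R), h != 0 ->
  B (h^-1 *: ((f \o shift t) (h *: 1) - f t)) by [].
move: H; rewrite (near_shift 0) => H.
apply: filterS H => h /=; rewrite subr0 addrK => H h0.
have -> : h%:A = h :> R by rewrite [LHS]mulr1.
by apply: H; rewrite -subr_eq0 addrK.
Qed.

End derive_on.

Section inner_product.
Context {R : realType} {m : nat}.
Variable ip : {dot 'cV[R]_m for idfun}.

Lemma ipC (u v : 'cV[R]_m) : ip u v = ip v u.
Proof. by rewrite hermC expr0 mul1r. Qed.

(** Expansion through the Gram matrix of the standard basis. Limits in ['cV[R]_m] are taken in the
    matrix topology, not in the norm of [ip]; this formula reduces the continuity of [ip] to that of
    the coordinates. *)
Lemma ip_coordE (u v : 'cV[R]_m) :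
  ip u v = \sum_i \sum_j u i 0 * v j 0 * ip (delta_mx i 0) (delta_mx j 0).
Proof.
have colE (w : 'cV[R]_m) : w = \sum_i w i 0 *: delta_mx i 0.
  by rewrite {1}(matrix_sum_delta w); apply: eq_bigr => i _; rewrite big_ord1.
rewrite {1}(colE u) {1}(colE v) linear_sumlz; apply: eq_bigr => i _.
rewrite linear_sumr; apply: eq_bigr => j _.
by rewrite linearZlr/= mulrA.
Qed.

Lemma cvg_ip {T : Type} {F : set_system T} {FF : Filter F}
    {u v : T -> 'cV[R]_m} {a b : 'cV[R]_m} :
  u s @[s --> F] --> a -> v s @[s --> F] --> b ->
  ip (u s) (v s) @[s --> F] --> ip a b.
Proof.
move=> ua vb; rewrite ip_coordE.
under eq_fun do rewrite ip_coordE.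
have coord w (c : 'cV[R]_m) i : w s @[s --> F] --> c ->
    w s i 0 @[s --> F] --> c i 0.
  move=> wc.
  apply: (@continuous_cvg _ _ _ _ _ w (fun M : 'cV[R]_m => M i 0) _ _ wc).
  exact: coord_continuous.
apply: cvg_big => [|i _]; first exact: add_continuous.
apply: cvg_big => [|j _]; first exact: add_continuous.
by apply: cvgMl; apply: cvgM; exact: coord.
Qed.

(** With [q] the difference quotient of [y], that of the squared norm is exactly
    [ip (q s) (y s) + ip (y t) (q s)]. Both terms converge, the first because [y s] tends to [y t],
    and symmetry makes the limits equal. *)
Lemma is_derive_on_sqnorm D t (y : R -> 'cV[R]_m) dy :
  is_derive_on D t y dy ->
  is_derive_on D t (fun s => ip (y s) (y s)) (2 * ip dy (y t)).
Proof.
move=> yD; have yt := is_derive_on_cvg yD.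
rewrite /is_derive_on mulr_natl mulr2n [X in _ + X]ipC.
pose q s := (s - t)^-1 *: (y s - y t).
have dyy : ip (q s) (y s) @[s --> within D t^'] --> ip dy (y t).
  exact: cvg_ip.
have ydy : ip (y t) (q s) @[s --> within D t^'] --> ip (y t) dy.
  by apply: cvg_ip => //; exact: cvg_cst.
apply: cvg_trans (cvgD dyy ydy).
apply: near_eq_cvg; near=> s => /=.
rewrite fctE/= /q linearZl_LR linearZr_LR/= linearBl !linearBr/=.
rewrite /GRing.scale/=; ring.
Unshelve. all: by end_near. Qed.

End inner_product.

(** Integrating factor: [h], the product of [g] and [expR (- (c * F x))], has a nonpositive
    derivative on the open interval, hence [h b <= h a]. *)
Lemma gronwall (R : realType) (a b c : R) (alpha g g' : R -> R) :
  a <= b ->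
  {within `[a, b], continuous alpha} -> {within `[a, b], continuous g} ->
  (forall s, s \in `]a, b[ -> is_derive s 1 g (g' s)) ->
  (forall s, s \in `]a, b[ -> g' s <= c * alpha s * g s) ->
  g b <= expR (c * \int[lebesgue_measure]_(s in `[a, b]) alpha s) * g a.
Proof.
move=> ab alphac gc gD g'le.
have alphai : lebesgue_measure.-integrable `[a, b] (EFin \o alpha).
  by apply: continuous_compact_integrable => //; exact: segment_compact.
pose F x := \int[lebesgue_measure]_(s in `[a, x]) alpha s.
have Fc : {within `[a, b], continuous F}.
  exact: parameterized_integral_continuous.
pose h x := g x * expR (- (c * F x)).
have hD s : s \in `]a, b[ ->
    is_derive s 1 h ((g' s - c * alpha s * g s) * expR (- (c * F s))).
  move=> sab; have := sab; rewrite in_itv/= => /andP[as_ sb].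
  have alphas : {for s, continuous alpha}.
    by apply: (within_continuous_continuous _ alphac) => //; exact: lt_trans sb.
  have [dF F'] := continuous_FTC1_closed sb alphai as_ alphas.
  rewrite derive1E in F'.
  have Fs : is_derive s 1 F (alpha s) by split.
  have eFs := is_derive1_comp (is_derive_expR _) (is_deriveN (is_deriveZ c Fs)).
  have /is_derive_eq := is_deriveM (gD s sab) eFs; apply.
  rewrite /h !fctE /GRing.scale/=; ring.
(* Continuity up to the endpoints lets the monotonicity criterion work with derivatives on the open
   interval only. *)
have hc : {within `[a, b], continuous h}.
  move=> x; apply: cvgM; first exact: gc.
  apply: continuous_cvg; first exact: continuous_expR.
  by apply: cvgN; apply: cvgMr; exact: Fc.
have /= : h b <= h a.
  apply: (ler0_derive1_le_cc _ _ hc); rewrite ?in_itv/= ?lexx ?ab//.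
    by move=> s /hD [].
  move=> s sab; rewrite derive1E (@derive_val _ _ _ _ _ _ _ (hD s sab)).
  by rewrite mulr_le0_ge0 ?expR_ge0// subr_le0 g'le.
(* [F a] is an integral over a single point, so [h a = g a]. *)
rewrite /h {2}/F set_itv1 Rintegral_set1 mulr0 oppr0 expR0 mulr1.
by rewrite expRN ler_pdivrMr ?expR_gt0// mulrC.
Qed.

Lemma is_derive_onB (R : realType) (V : normedModType R) (D : set R) (t : R)
    (f g : R -> V) (df dg : V) :
  is_derive_on D t f df -> is_derive_on D t g dg ->
  is_derive_on D t (fun s => f s - g s) (df - dg).
Proof.
move=> fD gD; apply: cvg_trans (cvgB fD gD).
apply: near_eq_cvg; near=> s.
rewrite !fctE/= -scalerBr !opprB.
by rewrite [in LHS]addrACA [in RHS]addrACA [- f t + _]addrC.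
Unshelve. all: by end_near. Qed.

(** Gronwall is applied with [c = 2] to the squared norm, which avoids differentiating a square root
    at 0; taking roots at the end halves the exponent. *)
Lemma ip_norm_linear_ode (R : realType) (m : nat)
    (ip : {dot 'cV[R]_m for idfun}) (A : R -> 'M[R]_m) (alpha : R -> R)
    (x : R -> 'cV[R]_m) (t : R) :
  {within `[0, +oo[, continuous alpha} ->
  (forall s (v : 'cV[R]_m), 0 <= s -> ip (A s *m v) v <= alpha s * ip v v) ->
  (forall s, 0 <= s -> is_derive_on `[0, +oo[ s x (A s *m x s)) ->
  0 <= t ->
  ip_norm ip (x t) <=
    expR (\int[lebesgue_measure]_(s in `[0, t]) alpha s) * ip_norm ip (x 0).
Proof.
move=> alphac A_alpha xD t0.
have sub0t : `[0, t] `<=` `[0, +oo[ by exact: subset_itvl.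
have gD s : s \in `[0, +oo[ -> is_derive_on `[0, +oo[ s
    (fun s => ip (x s) (x s)) (2 * ip (A s *m x s) (x s)).
  by rewrite in_itv/= andbT => s0; apply/is_derive_on_sqnorm/xD.
have gc : {within `[0, t], continuous (fun s => ip (x s) (x s))}.
  by apply: continuous_subspaceW sub0t _; exact: is_derive_on_continuous gD.
have := @gronwall R 0 t 2 alpha (fun s => ip (x s) (x s)) _ t0
  (continuous_subspaceW sub0t alphac) gc.
move=> /(_ (fun s => 2 * ip (A s *m x s) (x s))) H.
have {}H : ip (x t) (x t) <=
    expR (2 * \int[lebesgue_measure]_(s in `[0, t]) alpha s) * ip (x 0) (x 0).
  (* Only times [s > 0] occur here, where the derivative is two-sided; the one-sided derivative at 0
     has served for the continuity [gc]. *)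
  apply: H => s; rewrite in_itv/= => /andP[s0 _].
    apply: (@is_derive_on_interior _ _ `[0, +oo[); last first.
      by apply: gD; rewrite in_itv/= ltW.
    by rewrite interior_itv_bndy /= in_itv/= s0.
  by rewrite -mulrA ler_pM2l// A_alpha// ltW.
rewrite /ip_norm; apply: le_trans (ler_wsqrtr H) _.
rewrite expRM_natl sqrtrM ?exprn_ge0 ?expR_ge0//.
by rewrite sqrtr_sqr ger0_norm ?expR_ge0.
Qed.

Theorem mainTheorem7 (R : realType) (m : nat)
    (ip : {dot 'cV[R]_m for idfun})
    (A : R -> 'M[R]_m) (alpha : R -> R)
    (A_cont : {within `[0, +oo[, continuous A})
    (alpha_cont : {within `[0, +oo[, continuous alpha})
    (A_alpha : forall (t : R) (x : 'cV[R]_m), 0 <= t ->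
       ip (A t *m x) x <= alpha t * ip x x)
    (x1 x2 x3 : R -> 'cV[R]_m) (x1_0 x2_0 x3_0 : 'cV[R]_m)
    (x1_sol : is_linear_ode_solution A x1_0 x1)
    (x2_sol : is_linear_ode_solution A x2_0 x2)
    (x3_sol : is_linear_ode_solution A x3_0 x3)
    (t : R) (t_ge0 : 0 <= t) :
  d3 ip (x1 t) (x2 t) (x3 t) <=
    expR (3 * \int[lebesgue_measure]_(s in `[0, t]) alpha s) *
    d3 ip x1_0 x2_0 x3_0.
Proof.
have norm_diff (y z : R -> 'cV[R]_m) y0 z0 : is_linear_ode_solution A y0 y ->
    is_linear_ode_solution A z0 z ->
    ip_norm ip (y t - z t) <=
    expR (\int[lebesgue_measure]_(s in `[0, t]) alpha s) * ip_norm ip (y0 - z0).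
  move=> [<- yD] [<- zD].
  apply: (@ip_norm_linear_ode _ _ _ A _ (fun s => y s - z s)) => // s s0.
  (* By linearity the difference of two solutions solves the same system. *)
  by rewrite mulmxBr; apply: is_derive_onB; [exact: yD|exact: zD].
have norm_ge0 (v : 'cV[R]_m) : 0 <= ip_norm ip v by exact: sqrtr_ge0.
(* The exponential becomes a cube, one factor for each pairwise distance. *)
rewrite /d3 expRM_natl.
have := ler_pM _ _ (ler_pM _ _ (norm_diff _ _ _ _ x1_sol x2_sol)
  (norm_diff _ _ _ _ x1_sol x3_sol)) (norm_diff _ _ _ _ x2_sol x3_sol).
move=> /(_ _ _ _ _)/le_trans; apply; rewrite ?mulr_ge0//.
by rewrite le_eqVlt; apply/predU1P; left; ring.
Qed.
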